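(* Let $k$ be a commutative ring and let $A$ be a chain complex of $k$-modules, $\cdots\to A_{q+1}\xrightarrow{d}A_q\to\cdots$. The derived universal Massey product of $A$ (over the initial operad $I$) $$\gamma_A^{I}\in\prod_{q\in\mathbb Z}\operatorname{Ext}^2_k(H_q(A),H_{q+1}(A))$$ is represented by the opposite (i.e. the additive inverse) of the following sequence of extensions, $q\in\mathbb Z$: $$H_{q+1}(A)\hookrightarrow\frac{A_{q+1}}{d(A_{q+2})}\xrightarrow{\ d\ }\ker[A_q\xrightarrow{d}A_{q-1}]\twoheadrightarrow H_q(A).$$
   Context: The initial operad $I$ is $k$ concentrated in arity $1$ and degree $0$; its differential graded algebras are chain complexes. The definitions of derived homotopy algebras, minimal models and derived universal Massey products specialize to the following. A twisted complex (derived homotopy $I$-algebra) is a chain complex $X$ of $k$-modules with a splitting $X_n=\bigoplus_{p+q=n}X_{p,q}$, $X_{p,q}=0$ for $p<0$, such that the differential preserves the increasing filtration $F_mX=\bigoplus_{p\le m}X_{p,q}$; thus $d=\sum_{i\ge0}d_i$ with $d_i\colon X_{p,q}\to X_{p-i,q-1+i}$. A twisted map (derived $\infty$-morphism) $f\colon X\leadsto Y$ is a filtration-preserving chain map; thus $f=\sum_{i\ge0}f_i$ with $f_i\colon X_{p,q}\to Y_{p-i,q+i}$. It is an $E^2$-equivalence if it induces an isomorphism on the $E^2$ pages of the spectral sequences of the filtrations. A chain complex is regarded as a twisted complex concentrated in horizontal degree $p=0$. A derived minimal model of a chain complex $A$ is an $E^2$-equivalence $f\colon\tilde A\leadsto A$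 where $\tilde A$ is a twisted complex with projective $\tilde A_{p,q}$ for all $p,q$, and $d_0=0$; such models exist. Then $f_0\colon\tilde A\to A$ vanishes in positive horizontal degrees and takes values in cycles, and its composite $\rho\colon\tilde A\to H_*(A)$ with the projection from cycles to homology exhibits each $(\tilde A_{*,q},d_1)$ as a projective resolution of $H_q(A)$. For graded $k$-modules $H,M$ and projective resolutions $(\tilde H_{*,q},d_1)$ of $H_q$, $q\in\mathbb Z$, the derived operadic cohomology $\mathbb D H_I^{w,t}(H,M)$ is the cohomology of $C^{w,t}_I(\tilde H,M)=\prod_q\operatorname{Hom}(\tilde H_{w,q},M_{q-t})$ with differential $d(\psi)(x)=-(-1)^w\psi(d_1(x))$, so that $\mathbb D H_I^{w,t}(H,M)=\prod_q\operatorname{Ext}_k^w(H_q,M_{q-t})$. The derived universal Massey product $\gamma_A^I\in\mathbb D H_I^{2,-1}(H_*(A),H_*(A))=\prod_q\operatorname{Ext}^2_k(H_q(A),H_{q+1}(A))$ is the class of the cocycle given by $x\mapsto\rho(d_2(x))$, $x\in\tilde A_{2,q}$, $q\in\mathbb Z$, for any derived minimal model of $A$; it is independent of the choice of model. Convention: a $2$-fold Yoneda extension $X\hookrightarrow Y_1\to Y_0\twoheadrightarrow Z$ corresponds to the class in $\operatorname{Ext}^2_k(Z,X)$ of the cocycle $P_2\to X$ obtained from a chain map, lifting the identity of $Z$, from a projective resolution $P_*$ of $Z$ to the complex $X\to Y_1\to Y_0$. *)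

(* Defs.v *)
From HB Require Import structures.
From mathcomp Require Import all_boot all_order generic_quotient all_algebra.
From mathcomp Require Import ring_quotient.
From mathcomp Require Import boolp classical_sets functions zify.

Set Implicit Arguments.
Unset Strict Implicit.
Unset Printing Implicit Defensive.

Import Order.TTheory GRing.Theory Num.Theory.
Local Open Scope ring_scope.

Section Submodules.
Variables (k : comPzRingType) (V : lmodType k).

Record submodule (S : submodClosed V) :=
  Submodule {submodule_val :> V; _ : submodule_val \in S}.

HB.instance Definition _ (S : submodClosed V) := [isSub for @submodule_val S].
HB.instance Definition _ (S : submodClosed V) :=
  [Choice of submodule S by <:].
HB.instance Definition _ (S : submodClosed V) :=
  [SubChoice_isSubLmodule of submodule S by <:].

Lemma submodule_valP (S : submodClosed V) (x : submodule S) :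
  submodule_val x \in S.
Proof. by case: x. Qed.

Lemma submodule_val_is_linear (S : submodClosed V) :
  linear (@submodule_val S).
Proof. exact: (linearP (val : {linear submodule S -> V})). Qed.
HB.instance Definition _ (S : submodClosed V) :=
  GRing.isLinear.Build k (submodule S) V _ (@submodule_val S)
    (@submodule_val_is_linear S).

(* [submodClosed] predicates carry no canonical [zmodClosed] structure. *)
Definition zmod_pred (S : submodClosed V) : {pred V} := fun x => x \in S.
Lemma zmod_pred_closed (S : submodClosed V) : zmod_closed (zmod_pred S).
Proof.
split=> [|x y xS yS]; rewrite unfold_in; first exact: rpred0.
by rewrite rpredD // -scaleN1r rpredZ.
Qed.
HB.instance Definition _ (S : submodClosed V) :=
  GRing.isZmodClosed.Build V (zmod_pred S) (zmod_pred_closed S).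

Definition quotm (S : submodClosed V) : Type := Quotient.quot (zmod_pred S).
HB.instance Definition _ (S : submodClosed V) := GRing.Zmodule.on (quotm S).

Section QuotientModule.
Variable S : submodClosed V.

Definition quot_proj (x : V) : quotm S :=
  \pi_(Quotient.quot (zmod_pred S))%qT x.
Definition quot_repr (x : quotm S) : V :=
  repr (x : Quotient.quot (zmod_pred S)).

Lemma quot_reprK x : quot_proj (quot_repr x) = x.
Proof. exact: reprK. Qed.

Lemma quot_proj_eq x y : (quot_proj x == quot_proj y) = (x - y \in S).
Proof. by rewrite -(Quotient.idealrBE (zmod_pred S) x y). Qed.

Lemma quot_projD x y : quot_proj (x + y) = quot_proj x + quot_proj y.
Proof. exact: raddfD. Qed.

Definition quot_scale (a : k) (x : quotm S) : quotm S :=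
  quot_proj (a *: quot_repr x).

Lemma quot_projZ a x : quot_proj (a *: x) = quot_scale a (quot_proj x).
Proof.
apply/eqP; rewrite quot_proj_eq -scalerBr rpredZ // -quot_proj_eq.
by rewrite quot_reprK.
Qed.

Lemma quot_scaleA a b x :
  quot_scale a (quot_scale b x) = quot_scale (a * b) x.
Proof. by rewrite -[x]quot_reprK -!quot_projZ scalerA. Qed.

Lemma quot_scale1 : left_id 1 quot_scale.
Proof. by move=> x; rewrite -[x]quot_reprK -quot_projZ scale1r. Qed.

Lemma quot_scaleDr : right_distributive quot_scale +%R.
Proof.
move=> a x y; rewrite -[x]quot_reprK -[y]quot_reprK.
by rewrite -quot_projD -!quot_projZ -quot_projD scalerDr.
Qed.

Lemma quot_scaleDl x : {morph quot_scale^~ x : a b / a + b}.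
Proof.
move=> a b; rewrite -[x]quot_reprK.
by rewrite -!quot_projZ -quot_projD scalerDl.
Qed.

HB.instance Definition _ := GRing.Zmodule_isLmodule.Build k (quotm S)
  quot_scaleA quot_scale1 quot_scaleDr quot_scaleDl.

Lemma quot_proj_is_linear : linear quot_proj.
Proof. by move=> a x y; rewrite quot_projD quot_projZ. Qed.
HB.instance Definition _ :=
  GRing.isLinear.Build k V (quotm S) _ quot_proj quot_proj_is_linear.

Lemma quot_proj0 x : quot_proj x = 0 <-> x \in S.
Proof.
rewrite -[0](linear0 quot_proj); split=> [/eqP|xS].
  by rewrite quot_proj_eq subr0.
by apply/eqP; rewrite quot_proj_eq subr0.
Qed.

Section Lift.
Variables (W : lmodType k) (f : {linear V -> W}).
Hypothesis fS : forall x, x \in S -> f x = 0.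

Definition quot_lift of (forall x, x \in S -> f x = 0) : quotm S -> W :=
  fun x : quotm S => f (quot_repr x).

Lemma quot_liftE x : quot_lift fS (quot_proj x) = f x.
Proof.
apply/eqP; rewrite -subr_eq0 -linearB fS //.
by rewrite -quot_proj_eq quot_reprK.
Qed.

Lemma quot_lift_is_linear : linear (quot_lift fS).
Proof.
move=> a x y; rewrite -[x]quot_reprK -[y]quot_reprK.
by rewrite -linearP !quot_liftE linearP.
Qed.
HB.instance Definition _ :=
  GRing.isLinear.Build k (quotm S) W _ (quot_lift fS) quot_lift_is_linear.
End Lift.
End QuotientModule.

End Submodules.

Section Subquotient.
Variables (k : comPzRingType) (V : lmodType k) (S T : submodClosed V).

Definition restrict_pred : {pred submodule S} := fun x => val x \in T.
Lemma restrict_pred_closed : submod_closed restrict_pred.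
Proof.
split=> [|a x y xT yT]; rewrite unfold_in /=; first exact: rpred0.
by rewrite rpredD // rpredZ.
Qed.
HB.instance Definition _ :=
  GRing.isSubmodClosed.Build k (submodule S) restrict_pred restrict_pred_closed.

(* S / (S :&: T) *)
Definition subquot : lmodType k := quotm restrict_pred.
End Subquotient.
Arguments restrict_pred {k V} S T.

Section Codomain.
Variables (k : comPzRingType) (U V : lmodType k) (S : submodClosed V).
Variables (f : {linear U -> V}) (fS : forall x, f x \in S).

Definition into_submodule (x : U) : submodule S := Submodule (fS x).
Lemma into_submodule_is_linear : linear into_submodule.
Proof. by move=> a x y; apply: val_inj; rewrite /= linearP. Qed.
HB.instance Definition _ := GRing.isLinear.Build k U (submodule S) _
  into_submodule into_submodule_is_linear.
End Codomain.

Section KernelImage.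
Variables (k : comPzRingType) (U V : lmodType k) (f : {linear U -> V}).

Definition ker : {pred U} := fun x => f x == 0.
Lemma ker_closed : submod_closed ker.
Proof.
split=> [|a x y /eqP fx /eqP fy]; rewrite unfold_in; first by rewrite linear0.
by rewrite linearP fx fy scaler0 addr0.
Qed.
HB.instance Definition _ := GRing.isSubmodClosed.Build k U ker ker_closed.

Definition im : {pred V} := fun y => `[< exists x, f x = y >].
Lemma im_closed : submod_closed im.
Proof.
split=> [|a x y /asboolP[u <-] /asboolP[v <-]]; apply/asboolP.
  by exists 0; rewrite linear0.
by exists (a *: u + v); rewrite linearP.
Qed.
HB.instance Definition _ := GRing.isSubmodClosed.Build k V im im_closed.

Lemma kerP x : x \in ker <-> f x = 0.
Proof. by split=> /eqP. Qed.
Lemma imP y : y \in im <-> exists x, f x = y.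
Proof. by split=> /asboolP. Qed.
End KernelImage.

Section HomModule.
Variables (k : comPzRingType) (U V : lmodType k).

Definition Hom : Type := {linear U -> V}.
Identity Coercion linear_of_Hom : Hom >-> GRing.Linear.type.

Lemma Hom_ext (f g : Hom) : f =1 g -> f = g.
Proof.
case: f g => [f cf] [g cg] /= /funext E; subst g; congr GRing.Linear.Pack.
case: cf cg => [[m1] [m2]] [[n1] [n2]].
by rewrite (Prop_irrelevance m1 n1) (Prop_irrelevance m2 n2).
Qed.

HB.instance Definition _ := gen_eqMixin Hom.
HB.instance Definition _ := gen_choiceMixin Hom.

Let add (f g : Hom) : Hom := f \+ g.
Let opp (f : Hom) : Hom := \- f.
Let zero : Hom := \0.
Let scale (a : k) (f : Hom) : Hom := a \*: f.

Fact Hom_addA : associative add.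
Proof. by move=> f g h; apply: Hom_ext => x /=; rewrite addrA. Qed.
Fact Hom_addC : commutative add.
Proof. by move=> f g; apply: Hom_ext => x /=; rewrite addrC. Qed.
Fact Hom_add0 : left_id zero add.
Proof. by move=> f; apply: Hom_ext => x /=; rewrite add0r. Qed.
Fact Hom_addN : left_inverse zero opp add.
Proof. by move=> f; apply: Hom_ext => x /=; rewrite addNr. Qed.
HB.instance Definition _ :=
  GRing.isZmodule.Build Hom Hom_addA Hom_addC Hom_add0 Hom_addN.

Fact Hom_scaleA a b f : scale a (scale b f) = scale (a * b) f.
Proof. by apply: Hom_ext => x /=; rewrite scalerA. Qed.
Fact Hom_scale1 : left_id 1 scale.
Proof. by move=> f; apply: Hom_ext => x /=; rewrite scale1r. Qed.
Fact Hom_scaleDr : right_distributive scale +%R.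
Proof. by move=> a f g; apply: Hom_ext => x /=; rewrite scalerDr. Qed.
Fact Hom_scaleDl f : {morph scale^~ f : a b / a + b}.
Proof. by move=> a b; apply: Hom_ext => x /=; rewrite scalerDl. Qed.
HB.instance Definition _ := GRing.Zmodule_isLmodule.Build k Hom
  Hom_scaleA Hom_scale1 Hom_scaleDr Hom_scaleDl.
End HomModule.

Section PiModule.
Variables (k : comPzRingType) (I : Type) (V : I -> lmodType k).

Definition piM : Type := forall i, V i.
HB.instance Definition _ := Choice.copy piM (forall i, V i).

Let add (f g : piM) : piM := fun i => f i + g i.
Let opp (f : piM) : piM := fun i => - f i.
Let zero : piM := fun=> 0.
Let scale (a : k) (f : piM) : piM := fun i => a *: f i.

Fact piM_addA : associative add.
Proof.
by move=> f g h; apply: functional_extensionality_dep => i; apply: addrA.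
Qed.
Fact piM_addC : commutative add.
Proof.
by move=> f g; apply: functional_extensionality_dep => i; apply: addrC.
Qed.
Fact piM_add0 : left_id zero add.
Proof. by move=> f; apply: functional_extensionality_dep => i; apply: add0r. Qed.
Fact piM_addN : left_inverse zero opp add.
Proof.
by move=> f; apply: functional_extensionality_dep => i; apply: addNr.
Qed.
HB.instance Definition _ :=
  GRing.isZmodule.Build piM piM_addA piM_addC piM_add0 piM_addN.

Fact piM_scaleA a b f : scale a (scale b f) = scale (a * b) f.
Proof. by apply: functional_extensionality_dep => i; apply: scalerA. Qed.
Fact piM_scale1 : left_id 1 scale.
Proof.
by move=> f; apply: functional_extensionality_dep => i; apply: scale1r.
Qed.
Fact piM_scaleDr : right_distributive scale +%R.
Proof.
by move=> a f g; apply: functional_extensionality_dep => i; apply: scalerDr.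
Qed.
Fact piM_scaleDl f : {morph scale^~ f : a b / a + b}.
Proof.
by move=> a b; apply: functional_extensionality_dep => i; apply: scalerDl.
Qed.
HB.instance Definition _ := GRing.Zmodule_isLmodule.Build k piM
  piM_scaleA piM_scale1 piM_scaleDr piM_scaleDl.

Definition piM_proj i (f : piM) : V i := f i.
Fact piM_proj_is_linear i : linear (piM_proj i).
Proof. by []. Qed.
HB.instance Definition _ i :=
  GRing.isLinear.Build k piM (V i) _ (piM_proj i) (piM_proj_is_linear i).
End PiModule.

Section PiMap.
Variables (k : comPzRingType) (I : Type) (V W : I -> lmodType k).
Variable f : forall i, {linear V i -> W i}.

Definition piM_map (x : piM V) : piM W := fun i => f i (x i).
Fact piM_map_is_linear : linear piM_map.
Proof.
by move=> a x y; apply: functional_extensionality_dep => i; apply: linearP.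
Qed.
HB.instance Definition _ :=
  GRing.isLinear.Build k (piM V) (piM W) _ piM_map piM_map_is_linear.
End PiMap.

Section Precomposition.
Variables (k : comPzRingType) (U' U V : lmodType k) (f : {linear U' -> U}).

Definition precomp (g : Hom U V) : Hom U' V := g \o f.
Fact precomp_is_linear : linear precomp.
Proof. by move=> a g h; apply: Hom_ext. Qed.
HB.instance Definition _ :=
  GRing.isLinear.Build k (Hom U V) (Hom U' V) _ precomp precomp_is_linear.
End Precomposition.
Arguments precomp {k U' U} V f.

Section SubquotientMap.
Variables (k : comPzRingType) (U V : lmodType k).
Variables (S T : submodClosed U) (S' T' : submodClosed V).

Definition subquot_class (x : U) (xS : x \in S) : subquot S T :=
  quot_proj (restrict_pred S T) (Submodule xS).

Lemma subquot_class_surj (c : subquot S T) :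
  exists x (xS : x \in S), c = subquot_class xS.
Proof.
exists (val (quot_repr c)), (valP (quot_repr c)).
rewrite -[c in LHS]quot_reprK; congr quot_proj; exact: val_inj.
Qed.

Lemma subquot_class_eq x y (xS : x \in S) (yS : y \in S) :
  subquot_class xS = subquot_class yS <-> x - y \in T.
Proof.
split=> [/eqP|xyT].
  by rewrite quot_proj_eq unfold_in /= /restrict_pred.
by apply/eqP; rewrite quot_proj_eq unfold_in.
Qed.

Variable f : {linear U -> V}.
Hypothesis fS : forall x, x \in S -> f x \in S'.
Hypothesis fT : forall x, x \in S -> x \in T -> f x \in T'.

Let g : {linear submodule S -> subquot S' T'} :=
  quot_proj (restrict_pred S' T') \o
  into_submodule (f := f \o @submodule_val k U S) (fun x => fS (valP x)).

Fact subquot_map_subproof x : x \in restrict_pred S T -> g x = 0.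
Proof.
by move=> xT; apply/quot_proj0; rewrite unfold_in; apply: fT (valP x) xT.
Qed.

Definition subquot_map : {linear subquot S T -> subquot S' T'} :=
  quot_lift subquot_map_subproof.

Lemma subquot_mapE x (xS : x \in S) (fxS : f x \in S') :
  subquot_map (subquot_class xS) = quot_proj (restrict_pred S' T') (Submodule fxS).
Proof.
by rewrite [LHS]quot_liftE /=; congr quot_proj; apply: val_inj.
Qed.
End SubquotientMap.

Section Cohomology.
Variables (k : comPzRingType) (C : nat -> lmodType k).
Variable delta : forall w, {linear C w -> C w.+1}.

Definition coboundaries (w : nat) : submodClosed (C w) :=
  match w with
  | 0 => im (\0 : {linear C 0 -> C 0})
  | w'.+1 => im (delta w')
  end.

Definition cohomology (w : nat) : lmodType k :=
  subquot (ker (delta w)) (coboundaries w).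

Definition cohomology_class w (c : C w) (dc : delta w c = 0) : cohomology w :=
  subquot_class (coboundaries w) (introT eqP dc : c \in ker (delta w)).
End Cohomology.

Section Projective.
Variable k : comPzRingType.

Definition projective (P : lmodType k) : Prop :=
  forall (M N : lmodType k) (g : {linear M -> N}) (f : {linear P -> N}),
    (forall y, exists x, g x = y) ->
    exists h : {linear P -> M}, forall x, g (h x) = f x.

Lemma projective_lift (P M N : lmodType k) (g : {linear M -> N})
    (f : {linear P -> N}) :
  projective P -> (forall x, exists y, g y = f x) ->
  exists h : {linear P -> M}, forall x, g (h x) = f x.
Proof.
move=> projP fg.
have gI x : g x \in im g by apply/imP; exists x.
have fI x : f x \in im g by apply/imP.
have [|h hE] := projP _ _ (into_submodule gI) (into_submodule fI).
  move=> [y yI]; have [x gx] := (imP g y).1 yI.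
  by exists x; apply: val_inj.
by exists h => x; have [] := hE x.
Qed.

Record resolution (Z : lmodType k) := Resolution {
  res_obj :> nat -> lmodType k;
  res_d : forall w, {linear res_obj w.+1 -> res_obj w};
  res_aug : {linear res_obj 0 -> Z};
  res_proj : forall w, projective (res_obj w);
  res_surj : forall z, exists x, res_aug x = z;
  res_exact0 : forall x, res_aug x = 0 <-> exists y, res_d 0 y = x;
  res_exact : forall w x, res_d w x = 0 <-> exists y, res_d w.+1 y = x
}.

Lemma res_dd Z (P : resolution Z) w x : res_d P w (res_d P w.+1 x) = 0.
Proof. by apply/res_exact; exists x. Qed.

Lemma res_aug_d Z (P : resolution Z) x : res_aug P (res_d P 0 x) = 0.
Proof. by apply/res_exact0; exists x. Qed.

Definition Ext_d (Z : lmodType k) (P : resolution Z) (X : lmodType k) (w : nat) :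
    {linear Hom (P w) X -> Hom (P w.+1) X} :=
  precomp X (res_d P w).

Definition Ext (Z : lmodType k) (P : resolution Z) (w : nat) (X : lmodType k) :
    lmodType k :=
  cohomology (Ext_d P X) w.

Record yoneda2 (X Z : lmodType k) := Yoneda2 {
  yo1 : lmodType k;
  yo0 : lmodType k;
  yo_i : {linear X -> yo1};
  yo_m : {linear yo1 -> yo0};
  yo_p : {linear yo0 -> Z};
  yo_inj : injective yo_i;
  yo_exact1 : forall y, yo_m y = 0 <-> exists x, yo_i x = y;
  yo_exact0 : forall y, yo_p y = 0 <-> exists x, yo_m x = y;
  yo_surj : forall z, exists y, yo_p y = z
}.

Section YonedaClass.
Variables (X Z : lmodType k) (P : resolution Z) (E : yoneda2 X Z).

Record yoneda_lift := YonedaLift {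
  yl0 : Hom (P 0) (yo0 E);
  yl1 : Hom (P 1) (yo1 E);
  yl2 : Hom (P 2) X;
  yl_aug : forall x, yo_p E (yl0 x) = res_aug P x;
  yl_comm0 : forall x, yo_m E (yl1 x) = yl0 (res_d P 0 x);
  yl_comm1 : forall x, yo_i E (yl2 x) = yl1 (res_d P 1 x)
}.

Lemma yoneda_lift_exists : inhabited yoneda_lift.
Proof.
have [f0 f0E] := @res_proj _ P 0 _ _ (yo_p E) (res_aug P) (@yo_surj _ _ E).
have [|f1 f1E] := @projective_lift _ _ _ (yo_m E) (f0 \o res_d P 0)
    (@res_proj _ P 1).
  by move=> x; apply/yo_exact0; rewrite /= f0E res_aug_d.
have [|f2 f2E] := @projective_lift _ _ _ (yo_i E) (f1 \o res_d P 1)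
    (@res_proj _ P 2).
  by move=> x; apply/yo_exact1; rewrite /= f1E /= res_dd linear0.
by constructor; exact: (@YonedaLift f0 f1 f2 f0E f1E f2E).
Qed.

Lemma yl_cocycle (L : yoneda_lift) : Ext_d P X 2 (yl2 L) = 0.
Proof.
apply: Hom_ext => x /=; apply: (@yo_inj _ _ E).
by rewrite yl_comm1 res_dd !linear0.
Qed.

Definition lift_class (L : yoneda_lift) : Ext P 2 X :=
  cohomology_class (delta := Ext_d P X) (yl_cocycle L).

Lemma lift_class_unique (L L' : yoneda_lift) : lift_class L = lift_class L'.
Proof.
apply/subquot_class_eq/imP.
have [|h0 h0E] := @projective_lift _ _ _ (yo_m E)
    (yl0 L - yl0 L' : Hom _ _) (@res_proj _ P 0).
  by move=> x; apply/yo_exact0; rewrite linearB /= !yl_aug subrr.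
have [|h1 h1E] := @projective_lift _ _ _ (yo_i E)
    (yl1 L - yl1 L' - precomp _ (res_d P 0) h0 : Hom _ _) (@res_proj _ P 1).
  move=> x; apply/yo_exact1; rewrite !linearB /= !yl_comm0.
  by rewrite h0E /= subrr.
exists h1; apply: Hom_ext => x /=; apply: (@yo_inj _ _ E).
by rewrite h1E linearB /= !yl_comm1 res_dd linear0 subr0.
Qed.

Definition yoneda_class : Ext P 2 X :=
  lift_class (inhabited_witness yoneda_lift_exists).

Lemma yoneda_classE (L : yoneda_lift) : yoneda_class = lift_class L.
Proof. exact: lift_class_unique. Qed.
End YonedaClass.
End Projective.

Section Complexes.
Variable k : comPzRingType.

(* The differential is indexed by both its source and its target, and vanishes
   unless the degrees match; this avoids casts along equalities in [int]. *)
Record complex := Complex {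
  chain :> int -> lmodType k;
  diff : forall m n, {linear chain m -> chain n};
  diff_shape : forall m n x, m != n + 1 -> diff m n x = 0;
  diff_diff : forall l m n x, diff m n (diff l m x) = 0
}.

Definition cycles (A : complex) (q : int) : submodClosed (A q) :=
  ker (diff A q (q - 1)).
Definition boundaries (A : complex) (q : int) : submodClosed (A q) :=
  im (diff A (q + 1) q).
Definition homology (A : complex) (q : int) : lmodType k :=
  subquot (cycles A q) (boundaries A q).

Lemma cyclesP (A : complex) q n x : q = n + 1 ->
  x \in cycles A q <-> diff A q n x = 0.
Proof. by move=> /esym /(canRL (addrK _)) ->; exact: kerP. Qed.

Lemma boundariesP (A : complex) m q x : m = q + 1 ->
  x \in boundaries A q <-> exists y, diff A m q y = x.
Proof. by move=> ->; exact: imP. Qed.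

Record chain_map (A B : complex) := ChainMap {
  cmap :> forall n, {linear A n -> B n};
  cmap_diff : forall m n x, diff B m n (cmap m x) = cmap n (diff A m n x)
}.

Record filtered_complex := FilteredComplex {
  fc_complex :> complex;
  fil : int -> forall n, submodClosed (fc_complex n);
  fil_mono : forall p p' n x, p <= p' -> x \in fil p n -> x \in fil p' n;
  fil_diff : forall p m n x, x \in fil p m -> diff fc_complex m n x \in fil p n
}.

Record filtered_map (X Y : filtered_complex) := FilteredMap {
  fm_map :> chain_map X Y;
  fm_fil : forall p n x, x \in fil X p n -> fm_map n x \in fil Y p n
}.

(* Pages are indexed by the filtration degree p and the total degree n = p + q:
   E^r_p(n) = Z^r_p(n) / (Z^{r-1}_{p-1}(n) + d Z^{r-1}_{p+r-1}(n+1)), where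
   Z^r_p(n) = {x in F_p X_n | d x in F_{p-r} X_{n-1}}. *)
Section Pages.
Variables (X : filtered_complex) (r p n : int).

Definition pageZ : {pred X n} :=
  fun x => (x \in fil X p n) && (diff X n (n - 1) x \in fil X (p - r) (n - 1)).
Fact pageZ_closed : submod_closed pageZ.
Proof.
split=> [|a x y /andP[xF dxF] /andP[yF dyF]]; apply/andP; split.
- exact: rpred0.
- by rewrite linear0 rpred0.
- by rewrite rpredD // rpredZ.
- by rewrite linearP rpredD // rpredZ.
Qed.
HB.instance Definition _ := GRing.isSubmodClosed.Build k (X n) pageZ pageZ_closed.
End Pages.
Arguments pageZ X r p n : clear implicits.

Section PageBoundaries.
Variables (X : filtered_complex) (r p n : int).

Definition pageB : {pred X n} := fun x =>
  `[< exists y z, [/\ y \in pageZ X (r - 1) (p - 1) n,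
                      z \in pageZ X (r - 1) (p + r - 1) (n + 1) &
                      x = y + diff X (n + 1) n z] >].
Fact pageB_closed : submod_closed pageB.
Proof.
split=> [|a x x' /asboolP[y [z [yZ zZ ->]]] /asboolP[y' [z' [yZ' zZ' ->]]]];
  apply/asboolP.
  by exists 0, 0; rewrite !rpred0 linear0 addr0.
exists (a *: y + y'), (a *: z + z').
rewrite !(rpredD, rpredZ) //; split=> //.
by rewrite linearP scalerDr addrACA.
Qed.
HB.instance Definition _ := GRing.isSubmodClosed.Build k (X n) pageB pageB_closed.

Definition page : lmodType k := subquot (pageZ X r p n) pageB.
End PageBoundaries.
Arguments pageB X r p n : clear implicits.

Section PageMap.
Variables (X Y : filtered_complex) (f : filtered_map X Y) (r p n : int).

Lemma fm_pageZ s p' n' x : x \in pageZ X s p' n' -> f n' x \in pageZ Y s p' n'.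
Proof.
by move=> /andP[xF dxF]; apply/andP; split; rewrite ?cmap_diff fm_fil.
Qed.

Lemma fm_pageB x : x \in pageZ X r p n -> x \in pageB X r p n ->
  f n x \in pageB Y r p n.
Proof.
move=> _ /asboolP[y [z [yZ zZ ->]]]; apply/asboolP.
exists (f n y), (f (n + 1) z); split; try exact: fm_pageZ.
by rewrite linearD cmap_diff.
Qed.

Definition page_map : {linear page X r p n -> page Y r p n} :=
  subquot_map (@fm_pageZ r p n) fm_pageB.
End PageMap.

Definition E2_equivalence (X Y : filtered_complex) (f : filtered_map X Y) : Prop :=
  forall p n, bijective (page_map f 2 p n).

(* A decomposition C_n = \bigoplus_{p+q=n} C_{p,q} with C_{p,q} = 0 for p < 0,
   given by the injections of the summands and the projections onto them, which
   vanish unless p + q = n. *)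
Record splitting (C : complex) := Splitting {
  comp :> nat -> int -> lmodType k;
  inj : forall p q n, {linear comp p q -> C n};
  prj : forall p q n, {linear C n -> comp p q};
  inj_shape : forall p q n x, p%:Z + q != n -> inj p q n x = 0;
  prj_shape : forall p q n x, p%:Z + q != n -> prj p q n x = 0;
  prj_inj : forall p q n x, p%:Z + q = n -> prj p q n (inj p q n x) = x;
  prj_inj0 : forall p q p' q' n x, p != p' -> prj p' q' n (inj p q n x) = 0;
  inj_prj : forall n (y : C n), exists N : nat,
    y = \sum_(p < N) inj p (n - p%:Z) n (prj p (n - p%:Z) n y)
}.

(* F_m C_n is the sum of the C_{p,n-p} with p <= m. *)
Section SplittingFiltration.
Variables (C : complex) (S : splitting C) (m n : int).

Definition split_fil : {pred C n} := fun x =>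
  `[< forall (p : nat) q, m < p%:Z -> prj S p q n x = 0 >].
Fact split_fil_closed : submod_closed split_fil.
Proof.
split=> [|a x y /asboolP xF /asboolP yF]; apply/asboolP => p q mp.
  by rewrite linear0.
by rewrite linearP xF // yF // scaler0 addr0.
Qed.
HB.instance Definition _ :=
  GRing.isSubmodClosed.Build k (C n) split_fil split_fil_closed.

Lemma split_filP x : x \in split_fil <->
  forall (p : nat) q, m < p%:Z -> prj S p q n x = 0.
Proof. by split=> /asboolP. Qed.
End SplittingFiltration.
Arguments split_fil {C} S m n.

Record twisted := Twisted {
  tw_complex :> complex;
  tw_split : splitting tw_complex;
  tw_diff : forall p m n (x : tw_complex m), x \in split_fil tw_split p m ->
    diff tw_complex m n x \in split_fil tw_split p n
}.

Lemma split_fil_mono C (S : splitting C) p p' n (x : C n) :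
  p <= p' -> x \in split_fil S p n -> x \in split_fil S p' n.
Proof.
move=> le_pp' /split_filP xF; apply/split_filP => i q lt_p'i.
by apply: xF; apply: le_lt_trans lt_p'i.
Qed.

Definition tw_filtered (X : twisted) : filtered_complex :=
  FilteredComplex (@split_fil_mono _ (tw_split X)) (@tw_diff X).

Definition twisted_map (X Y : twisted) : Type :=
  filtered_map (tw_filtered X) (tw_filtered Y).

(* The component d_{p-p'} : X_{p,q} -> X_{p',q'} of the differential; it vanishes
   unless p' + q' = p + q - 1. *)
Definition tw_d (X : twisted) (p : nat) (q : int) (p' : nat) (q' : int) :
    {linear tw_split X p q -> tw_split X p' q'} :=
  prj (tw_split X) p' q' (p%:Z + q - 1)
    \o (diff X (p%:Z + q) (p%:Z + q - 1) \o inj (tw_split X) p q (p%:Z + q)).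

(* The component f_{p-p'} : X_{p,q} -> Y_{p',q'}; it vanishes unless
   p' + q' = p + q. *)
Definition tw_f (X Y : twisted) (f : twisted_map X Y)
    (p : nat) (q : int) (p' : nat) (q' : int) :
    {linear tw_split X p q -> tw_split Y p' q'} :=
  prj (tw_split Y) p' q' (p%:Z + q)
    \o (f (p%:Z + q) \o inj (tw_split X) p q (p%:Z + q)).

Lemma tw_dE (X : twisted) p q p' q' n n' x : n = p%:Z + q -> n = n' + 1 ->
  tw_d X p q p' q' x =
  prj (tw_split X) p' q' n' (diff X n n' (inj (tw_split X) p q n x)).
Proof. by move=> -> /esym /(canRL (addrK _)) ->. Qed.

Lemma tw_fE (X Y : twisted) (f : twisted_map X Y) p q p' q' n x : n = p%:Z + q ->
  tw_f f p q p' q' x = prj (tw_split Y) p' q' n (f n (inj (tw_split X) p q n x)).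
Proof. by move=> ->. Qed.

Section Concentrated.
Variable A : complex.

(* The identity of [A q] if [q = n], and zero otherwise. *)
Definition degree_cast (q n : int) : {linear A q -> A n} :=
  match q =P n with
  | ReflectT e => eq_rect q (fun n' => {linear A q -> A n'}) idfun n e
  | ReflectF _ => \0
  end.

Lemma degree_cast_id q x : degree_cast q q x = x.
Proof.
by rewrite /degree_cast; case: eqP => // e; rewrite (eq_irrelevance e erefl).
Qed.

Lemma degree_cast0 q n x : q != n -> degree_cast q n x = 0.
Proof. by rewrite /degree_cast; case: eqP. Qed.

Definition conc_comp (p : nat) (q : int) : lmodType k :=
  if p is 0 then A q else 'rV[k]_0.

Definition conc_inj p q n : {linear conc_comp p q -> A n} :=
  match p return {linear conc_comp p q -> A n} with
  | 0 => degree_cast q n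
  | _.+1 => \0
  end.

Definition conc_prj p q n : {linear A n -> conc_comp p q} :=
  match p return {linear A n -> conc_comp p q} with
  | 0 => degree_cast n q
  | _.+1 => \0
  end.

Fact conc_inj_shape p q n x : p%:Z + q != n -> conc_inj p q n x = 0.
Proof. by case: p x => [|p] x //=; rewrite add0r; exact: degree_cast0. Qed.
Fact conc_prj_shape p q n x : p%:Z + q != n -> conc_prj p q n x = 0.
Proof. by case: p => [|p] //=; rewrite add0r eq_sym; exact: degree_cast0. Qed.
Fact conc_prj_inj p q n x : p%:Z + q = n -> conc_prj p q n (conc_inj p q n x) = x.
Proof.
case: p x => [|p] x /=; last by move=> _; apply/rowP => -[].
by rewrite add0r => <-; rewrite !degree_cast_id.
Qed.
Fact conc_prj_inj0 p q p' q' n x : p != p' ->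
  conc_prj p' q' n (conc_inj p q n x) = 0.
Proof. by case: p x p' => [|p] x [|p'] //= _; rewrite linear0. Qed.
Fact conc_inj_prj n (y : A n) : exists N : nat,
  y = \sum_(p < N) conc_inj p (n - p%:Z) n (conc_prj p (n - p%:Z) n y).
Proof. by exists 1%N; rewrite big_ord1 /= subr0 !degree_cast_id. Qed.

Definition conc_splitting : splitting A :=
  Splitting conc_inj_shape conc_prj_shape conc_prj_inj conc_prj_inj0 conc_inj_prj.

Lemma conc_filP (m : int) n (x : A n) :
  x \in split_fil conc_splitting m n <-> (m < 0 -> x = 0).
Proof.
split=> [/split_filP xF m_lt0|x0].
  by have := xF 0%N n m_lt0; rewrite /= degree_cast_id.
apply/split_filP => -[|p] q //= m_lt0.
by rewrite x0 // linear0.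
Qed.

Fact conc_diff p m n (x : A m) : x \in split_fil conc_splitting p m ->
  diff A m n x \in split_fil conc_splitting p n.
Proof. by move=> /conc_filP x0; apply/conc_filP => /x0 ->; rewrite linear0. Qed.

Definition concentrated : twisted := Twisted conc_diff.
End Concentrated.

Record minimal_model (A : complex) := MinimalModel {
  mm_tw :> twisted;
  mm_map : twisted_map mm_tw (concentrated A);
  mm_E2 : E2_equivalence mm_map;
  mm_proj : forall p q, projective (tw_split mm_tw p q);
  mm_d0 : forall p q x, tw_d mm_tw p q p (q - 1) x = 0
}.
End Complexes.
Arguments pageZ {k} X r p n.
Arguments pageB {k} X r p n.
Arguments split_fil {k C} S m n.

Section DerivedCohomology.
Variables (k : comPzRingType) (H : int -> lmodType k).
Variables (P : forall q, resolution (H q)) (M : int -> lmodType k).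

Definition DH_cochain (t : int) (w : nat) : lmodType k :=
  piM (fun q => Hom (P q w) (M (q - t))).

Definition DH_d (t : int) (w : nat) :
    {linear DH_cochain t w -> DH_cochain t w.+1} :=
  piM_map (fun q => (- (-1) ^+ w) \*: Ext_d (P q) (M (q - t)) w).

Definition DH (w : nat) (t : int) : lmodType k := cohomology (DH_d t) w.

Lemma DH_dE t w (psi : DH_cochain t w) q x :
  (DH_d t w psi q : Hom _ _) x = - (-1) ^+ w *: (psi q : Hom _ _) (res_d (P q) w x).
Proof. by []. Qed.

Lemma DH_ker t w (psi : DH_cochain t w) q :
  psi \in ker (DH_d t w) -> psi q \in ker (Ext_d (P q) (M (q - t)) w).
Proof.
move=> /kerP E; apply/kerP.
have /(congr1 (fun f : DH_cochain t w.+1 => f q)) := E.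
rewrite /= /piM_map /= => /(congr1 (fun v => - (-1) ^+ w *: v)).
by rewrite scaler0 scalerA mulrNN -expr2 sqrr_sign scale1r.
Qed.

Lemma DH_coboundary t w (psi : DH_cochain t w) q :
  psi \in coboundaries (DH_d t) w ->
  psi q \in coboundaries (Ext_d (P q) (M (q - t))) w.
Proof.
case: w psi => [|w] psi /imP[phi <-]; apply/imP; first by exists 0.
by exists (- (-1) ^+ w *: phi q); rewrite linearZ.
Qed.

(* The q-th component of the isomorphism of the derived cohomology with the product
   of the groups Ext^w(H_q, M_{q-t}). *)
Definition DH_Ext (w : nat) (t : int) (q : int) :
    {linear DH w t -> Ext (P q) w (M (q - t))} :=
  subquot_map (f := @piM_proj k int (fun q => Hom (P q w) (M (q - t))) q)
    (fun psi => @DH_ker t w psi q)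
    (fun psi _ => @DH_coboundary t w psi q).

Lemma DH_Ext_inj w t (c c' : DH w t) :
  (forall q, DH_Ext w t q c = DH_Ext w t q c') -> c = c'.
Proof.
have [psi [psiK ->]] := subquot_class_surj c.
have [phi [phiK ->]] := subquot_class_surj c'.
move=> E; apply/subquot_class_eq.
have {E} E q : psi q - phi q \in coboundaries (Ext_d (P q) (M (q - t))) w.
  have := E q; rewrite !(subquot_mapE _ _ _ (DH_ker q _)) => /subquot_class_eq.
  exact.
clear c c'; case: w psi phi psiK phiK E => [|w] psi phi _ _ E.
  apply/imP; exists 0; apply: functional_extensionality_dep => q.
  by have /imP[? /= E0] := E q; exact: E0.
have /(_ _)/imP/cid h q := E q.
apply/imP; exists (fun q => - (-1) ^+ w *: projT1 (h q) : Hom _ _).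
apply: functional_extensionality_dep => q.
rewrite /= /piM_map /= linearZ scalerA mulrNN -expr2 sqrr_sign scale1r.
exact: (projT2 (h q)).
Qed.

Lemma DH_Ext_surj w t (e : forall q, Ext (P q) w (M (q - t))) :
  exists c : DH w t, forall q, DH_Ext w t q c = e q.
Proof.
pose psi q := projT1 (cid (subquot_class_surj (e q))).
have psiK q := projT1 (cid (projT2 (cid (subquot_class_surj (e q))))).
have K : (psi : DH_cochain t w) \in ker (DH_d t w).
  apply/kerP; apply: functional_extensionality_dep => q.
  by have /kerP := psiK q; rewrite /= /piM_map /= => ->; rewrite scaler0.
exists (subquot_class _ K) => q.
rewrite (subquot_mapE _ _ K
  (psiK q : piM_proj q (psi : DH_cochain t w) \in _)).
rewrite (projT2 (cid (projT2 (cid (subquot_class_surj (e q)))))).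
by apply/subquot_class_eq; rewrite subrr rpred0.
Qed.
End DerivedCohomology.
Arguments DH_Ext {k H P M w t} q.

Section HomologyExtension.
Variables (k : comPzRingType) (A : complex k) (q : int).

Let B := boundaries A (q + 1).

Let i0 : {linear submodule (cycles A (q + 1)) -> quotm B} :=
  quot_proj B \o @submodule_val k _ (cycles A (q + 1)).
Fact hext_i_subproof x : x \in restrict_pred (cycles A (q + 1)) B -> i0 x = 0.
Proof. by move=> xB; apply/quot_proj0. Qed.
Definition hext_i : {linear homology A (q + 1) -> quotm B} :=
  quot_lift hext_i_subproof.
Lemma hext_iE x (xZ : x \in cycles A (q + 1)) :
  hext_i (subquot_class B xZ) = quot_proj B x.
Proof. by rewrite [LHS]quot_liftE. Qed.

Fact hext_d_subproof x : diff A (q + 1) q x \in cycles A q.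
Proof. by apply/kerP; rewrite diff_diff. Qed.
Fact hext_m_subproof x : x \in B -> into_submodule hext_d_subproof x = 0.
Proof. by move=> /imP[y <-]; apply: val_inj; rewrite /= diff_diff. Qed.
Definition hext_m : {linear quotm B -> submodule (cycles A q)} :=
  quot_lift hext_m_subproof.
Lemma hext_mE x : hext_m (quot_proj B x) = Submodule (hext_d_subproof x).
Proof. by rewrite [LHS]quot_liftE. Qed.

Definition hext_p : {linear submodule (cycles A q) -> homology A q} :=
  quot_proj (restrict_pred (cycles A q) (boundaries A q)).

Fact hext_inj : injective hext_i.
Proof.
move=> c c'; have [x [xZ ->]] := subquot_class_surj c.
have [y [yZ ->]] := subquot_class_surj c'.
rewrite !hext_iE => /eqP; rewrite quot_proj_eq => xyB.
exact/subquot_class_eq.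
Qed.

Fact hext_exact1 y : hext_m y = 0 <-> exists x, hext_i x = y.
Proof.
rewrite -[y]quot_reprK; set x := quot_repr y; rewrite hext_mE; split.
  move=> [] dx; have xZ : x \in cycles A (q + 1) by apply/(cyclesP x erefl).
  by exists (subquot_class _ xZ); rewrite hext_iE.
move=> [c]; have [z [zZ ->]] := subquot_class_surj c.
rewrite hext_iE => /eqP; rewrite quot_proj_eq => /imP[u zx].
have {zx} -> : x = z - diff A (q + 1 + 1) (q + 1) u by rewrite zx subKr.
apply: val_inj; rewrite /= linearB diff_diff subr0.
exact/(cyclesP z erefl).
Qed.

Fact hext_exact0 y : hext_p y = 0 <-> exists x, hext_m x = y.
Proof.
split=> [/quot_proj0 /imP[x dx]|[x <-]].
  by exists (quot_proj B x); rewrite hext_mE; apply: val_inj.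
rewrite -[x]quot_reprK hext_mE; apply/quot_proj0/imP.
by exists (quot_repr x).
Qed.

Fact hext_surj z : exists y, hext_p y = z.
Proof. by exists (quot_repr z); exact: quot_reprK. Qed.

Definition homology_extension : yoneda2 (homology A (q + 1)) (homology A q) :=
  Yoneda2 hext_inj hext_exact1 hext_exact0 hext_surj.
End HomologyExtension.

Section TwistedTheory.
Variables (k : comPzRingType) (X : twisted k).
Local Notation S := (tw_split X).
Local Notation F := (fil (tw_filtered X)).

Lemma split_eq0 n (x : X n) : (forall p q, prj S p q n x = 0) -> x = 0.
Proof.
move=> x0; have [N ->] := inj_prj S x.
by rewrite big1 // => i _; rewrite x0 linear0.
Qed.

Lemma inj_fil p q n x : inj S p q n x \in F p%:Z n.
Proof. by apply/split_filP => p' q' lt_pp'; apply: prj_inj0; lia. Qed.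

Lemma fil_neg (m n : int) (x : X n) : m < 0 -> x \in F m n -> x = 0.
Proof.
move=> m0 /split_filP xF; apply: split_eq0 => p q; apply: xF.
exact: lt_le_trans m0 _.
Qed.

Lemma fil_pred (p : nat) (q n : int) (x : X n) : p%:Z + q = n -> x \in F p%:Z n ->
  prj S p q n x = 0 -> x \in F (p%:Z - 1) n.
Proof.
move=> npq /split_filP xF x0; apply/split_filP => p' q' lt_pp'.
have [->|ne_pp'] := eqVneq p' p; last by apply: xF; lia.
have [E|/prj_shape->//] := eqVneq (p%:Z + q') n.
by have -> : q' = q by lia.
Qed.

Lemma fil_lead (p : nat) (q n : int) (x : X n) : p%:Z + q = n -> x \in F p%:Z n ->
  x - inj S p q n (prj S p q n x) \in F (p%:Z - 1) n.
Proof.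
move=> npq xF; apply: (fil_pred npq); last by rewrite linearB prj_inj // subrr.
by rewrite -scaleN1r rpredD // rpredZ // inj_fil.
Qed.

Lemma prj_fil m p q n (x : X n) : m < p%:Z -> x \in F m n -> prj S p q n x = 0.
Proof. by move=> mp /split_filP; apply. Qed.

Lemma inj_prj0 q (x : X q) : x \in F 0 q -> inj S 0 q q (prj S 0 q q x) = x.
Proof.
move=> xF; apply/esym/eqP; rewrite -subr_eq0; apply/eqP.
by apply: (@fil_neg (0%:Z - 1)) => //; apply: fil_lead; rewrite ?add0r.
Qed.

Hypothesis d0 : forall p q x, tw_d X p q p (q - 1) x = 0.

Lemma diff_fil (p n n' : int) (x : X n) : n = n' + 1 -> x \in F p n ->
  diff X n n' x \in F (p - 1) n'.
Proof.
move=> nn' xF; have [p_lt0|] := ltP p 0.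
  by rewrite (fil_neg p_lt0 xF) linear0 rpred0.
case: p xF => // p xF _.
have dxF : diff X n n' x \in F p n' by exact: tw_diff.
apply: (@fil_pred _ (n' - p%:Z)) => //; first by lia.
have := fil_lead (_ : p%:Z + (n - p%:Z) = n) xF.
move=> /(_ ltac:(lia)); set y := inj _ _ _ _ _ => xyF.
rewrite -[x](subrK y) linearD linearD.
rewrite (@prj_fil (p%:Z - 1)) ?add0r; [|lia|exact: tw_diff].
rewrite -(@tw_dE _ X) //; last by lia.
have -> : n' - p%:Z = (n - p%:Z) - 1 by lia.
exact: d0.
Qed.

Lemma prj_diff (p : nat) (q n n' : int) (x : X n) : n = n' + 1 -> n' = p%:Z + q ->
  x \in F p.+1%:Z n ->
  prj S p q n' (diff X n n' x) = tw_d X p.+1 q p q (prj S p.+1 q n x).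
Proof.
move=> nn' n'E xF.
have := fil_lead (_ : p.+1%:Z + q = n) xF.
move=> /(_ ltac:(lia)) /(diff_fil nn'); set y := inj _ _ _ _ _ => xyF.
rewrite -[x in LHS](subrK y) linearD linearD (prj_fil _ _ xyF); last by lia.
by rewrite add0r (@tw_dE _ X _ _ _ _ n n') //; lia.
Qed.

End TwistedTheory.

Section MinimalModel.
Variables (k : comPzRingType) (A : complex k) (mm : minimal_model A).
Local Notation X := (mm_tw mm).
Local Notation S := (tw_split X).
Local Notation f := (mm_map mm).
Local Notation F := (fil (tw_filtered X)).
Let d0 := mm_d0 (m := mm).

Definition mm_f0 (q : int) : {linear S 0 q -> A q} := tw_f f 0 q 0 q.

Lemma mm_f0E q x : mm_f0 q x = f q (inj S 0 q q x).
Proof.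
by rewrite /mm_f0 (@tw_fE _ _ _ _ _ _ _ _ q) ?add0r //= degree_cast_id.
Qed.

Lemma diff_inj0 q n x : q = n + 1 -> diff X q n (inj S 0 q q x) = 0.
Proof.
move=> qn; apply: (@fil_neg _ X (0 - 1)) => //.
by have := diff_fil d0 qn (inj_fil q x).
Qed.

Fact mm_f0_cycle q x : mm_f0 q x \in cycles A q.
Proof.
apply/(@cyclesP _ A q (q - 1)); first by rewrite subrK.
by rewrite mm_f0E cmap_diff diff_inj0 ?subrK // linear0.
Qed.

Definition mm_rho (q : int) : {linear S 0 q -> homology A q} :=
  quot_proj (restrict_pred (cycles A q) (boundaries A q))
    \o into_submodule (@mm_f0_cycle q).

Lemma mm_rhoE q x : mm_rho q x = subquot_class (boundaries A q) (mm_f0_cycle x).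
Proof. by []. Qed.

Lemma mm_rho0 q x : mm_rho q x = 0 <-> mm_f0 q x \in boundaries A q.
Proof. exact: quot_proj0. Qed.

Definition mm_d1 (q : int) (w : nat) : {linear S w.+1 q -> S w q} :=
  tw_d X w.+1 q w q.

Lemma page_concE p n (x : A n) :
  x \in pageZ (tw_filtered (concentrated A)) 2 p n ->
  x \in pageB (tw_filtered (concentrated A)) 2 p n <->
  (p = 0 -> x \in boundaries A n).
Proof.
move=> /andP[/conc_filP xF /conc_filP dxF]; split.
  move=> /asboolP[y [z [/andP[/conc_filP y0 _] _ ->]]] p0; apply/imP.
  by exists z; rewrite y0 ?add0r //; lia.
move=> xB; apply/asboolP.
have [p0|p_gt0|p0] := ltgtP p 0.
- exists 0, 0; rewrite !rpred0 linear0 addr0; split=> //; exact: xF.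
- exists x, 0; rewrite linear0 addr0 rpred0; split=> //.
  apply/andP; split; apply/conc_filP => ?; first by lia.
  by apply: dxF; lia.
- have /imP[z <-] := xB p0.
  exists 0, z; rewrite rpred0 add0r; split=> //.
  by apply/andP; split; apply/conc_filP => ?; lia.
Qed.

Lemma page_modelZ (p : nat) q n (x : X n) : n = p%:Z + q ->
  x \in pageZ (tw_filtered X) 2 p n <->
  x \in F p n /\
  (if p is p'.+1 return S p q -> Prop
   then fun y => tw_d X p'.+1 q p' q y = 0 else fun=> True) (prj S p q n x).
Proof.
move=> nE; split.
  case/andP=> xF dxF; split=> //; case: p nE xF dxF => // p nE xF dxF.
  rewrite -(prj_diff d0 (n' := n - 1)) ?subrK //; last by lia.
  by apply: prj_fil dxF; lia.
case=> xF x0; apply/andP; split=> //.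
have dxF := diff_fil d0 (esym (subrK 1 n)) xF.
case: p nE xF x0 dxF => [|p] nE xF x0 dxF.
  by rewrite (fil_neg _ dxF) ?rpred0.
have -> : p.+1%:Z - 2 = p%:Z - 1 by lia.
have E : p.+1%:Z - 1 = p by lia.
rewrite E in dxF.
apply: (@fil_pred _ _ _ q) => //; first by lia.
by rewrite (prj_diff d0) ?subrK //; lia.
Qed.

Lemma page_modelB (p : nat) q n (x : X n) : n = p%:Z + q ->
  x \in pageZ (tw_filtered X) 2 p n ->
  x \in pageB (tw_filtered X) 2 p n <->
  exists y, tw_d X p.+1 q p q y = prj S p q n x.
Proof.
move=> nE xZ; split.
  move=> /asboolP[y [z [/andP[yF _] /andP[zF _] ->]]].
  exists (prj S p.+1 q (n + 1) z).
  have E : p%:Z + 2 - 1 = p.+1 by lia.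
  rewrite E in zF.
  by rewrite linearD (prj_fil _ _ yF) ?add0r ?(prj_diff d0) //; lia.
case=> y yE; apply/asboolP.
have [xF _] := andP xZ.
pose z := inj S p.+1 q (n + 1) y.
have zF : z \in F p.+1 (n + 1) by exact: inj_fil.
have dzF : diff X (n + 1) n z \in F p n.
  by have := diff_fil d0 erefl zF; have -> : p.+1%:Z - 1 = p by lia.
exists (x - diff X (n + 1) n z), z; split; last by rewrite subrK.
  have yF : x - diff X (n + 1) n z \in F (p%:Z - 1) n.
    apply: (@fil_pred _ _ _ q); first by lia.
      by rewrite -scaleN1r rpredD // rpredZ.
    by rewrite linearB (prj_diff d0) // prj_inj ?yE ?subrr //; lia.
  apply/andP; split=> //.
  have -> : p%:Z - 1 - (2 - 1) = p%:Z - 1 - 1 by lia.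
  by have := diff_fil d0 (esym (subrK 1 n)) yF.
apply/andP; split.
  by have -> : p%:Z + 2 - 1 = p.+1 by lia.
have -> : p%:Z + 2 - 1 - (2 - 1) = p by lia.
by have := diff_fil d0 (esym (subrK 1 (n + 1))) zF; have -> : p.+1%:Z - 1 = p by lia.
Qed.

Lemma mm_d1d1 q w x : mm_d1 q w (mm_d1 q w.+1 x) = 0.
Proof.
pose n := w%:Z + q; pose y := inj S w.+2 q (n + 1 + 1) x.
have yF : y \in F w.+2 (n + 1 + 1) by exact: inj_fil.
have xE : prj S w.+2 q (n + 1 + 1) y = x by apply: prj_inj; rewrite /n; lia.
rewrite /mm_d1 -xE -(prj_diff d0 (n' := n + 1)) //; last by rewrite /n; lia.
rewrite -(prj_diff d0 (n' := n)) ?diff_diff ?linear0 //.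
have -> : w.+1%:Z = w.+2%:Z - 1 by lia.
exact: diff_fil.
Qed.

Lemma mm_rho_d1 q x : mm_rho q (mm_d1 q 0 x) = 0.
Proof.
apply/mm_rho0/imP; rewrite mm_f0E.
pose y := inj S 1 q (q + 1) x.
have yF : y \in F 1 (q + 1) by exact: inj_fil.
have xE : prj S 1 q (q + 1) y = x by apply: prj_inj; lia.
exists (f (q + 1) y).
rewrite /mm_d1 -xE -(prj_diff d0 (n' := q)) ?add0r //.
rewrite cmap_diff inj_prj0 //.
exact: (diff_fil d0 _ yF).
Qed.

Lemma mm_rho_surj q h : exists x, mm_rho q x = h.
Proof.
have [a [aZ ->]] := subquot_class_surj h.
have aP : a \in pageZ (tw_filtered (concentrated A)) 2 0 q.
  apply/andP; split; apply/conc_filP => // _; exact/kerP.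
have [g _ gK] := mm_E2 mm 0 q.
have := gK (subquot_class _ aP).
have [x [xZ ->]] := subquot_class_surj (g (subquot_class _ aP)).
rewrite (subquot_mapE _ _ _ (fm_pageZ f xZ)) => /subquot_class_eq aB.
have [xF _] := andP xZ.
exists (prj S 0 q q x); rewrite mm_rhoE.
apply/subquot_class_eq; rewrite mm_f0E inj_prj0 //.
have abZ : f q x - a \in pageZ (tw_filtered (concentrated A)) 2 0 q.
  by rewrite -scaleN1r rpredD ?rpredZ // fm_pageZ.
exact: (page_concE abZ).1 aB _.
Qed.

Lemma mm_page_inj p n x : x \in pageZ (tw_filtered X) 2 p n ->
  f n x \in pageB (tw_filtered (concentrated A)) 2 p n ->
  x \in pageB (tw_filtered X) 2 p n.
Proof.
move=> xZ fxB; have /bij_inj I := mm_E2 mm p n.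
rewrite -[x]subr0.
apply/(subquot_class_eq _ xZ (rpred0 _)); apply: I.
rewrite (subquot_mapE _ _ _ (fm_pageZ f xZ)).
rewrite (subquot_mapE _ _ _ (fm_pageZ f (rpred0 _))).
by apply/subquot_class_eq; rewrite linear0 subr0.
Qed.

Lemma mm_exact0 q x : mm_rho q x = 0 <-> exists y, mm_d1 q 0 y = x.
Proof.
split=> [/mm_rho0|[y <-]]; last exact: mm_rho_d1.
rewrite mm_f0E => fxB; pose y := inj S 0 q q x.
have yx : prj S 0 q q y = x by rewrite prj_inj ?add0r.
have yZ : y \in pageZ (tw_filtered X) 2 0 q.
  by apply/(@page_modelZ 0%N q) => //; [lia|split=> //; exact: inj_fil].
rewrite -yx; apply/(@page_modelB 0%N q) => //; first by lia.
by apply: mm_page_inj => //; apply/page_concE; first exact: fm_pageZ.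
Qed.

Lemma mm_exact q w x : mm_d1 q w x = 0 <-> exists y, mm_d1 q w.+1 y = x.
Proof.
split=> [x0|[y <-]]; last exact: mm_d1d1.
pose n := w.+1%:Z + q; pose y := inj S w.+1 q n x.
have yx : prj S w.+1 q n y = x by exact: prj_inj.
have yZ : y \in pageZ (tw_filtered X) 2 w.+1 n.
  by apply/(@page_modelZ w.+1 q) => //; rewrite yx; split=> //; exact: inj_fil.
rewrite -yx; apply/(@page_modelB w.+1 q) => //.
by apply: mm_page_inj => //; apply/page_concE; first exact: fm_pageZ.
Qed.

Definition mm_resolution (q : int) : resolution (homology A q) :=
  @Resolution _ _ (fun w => S w q) (mm_d1 q) (mm_rho q)
    (fun w => @mm_proj _ _ mm w q) (@mm_rho_surj q) (@mm_exact0 q) (@mm_exact q).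

(* The target H_{q-t} at t = -1 is convertible to [homology A (q + 1)]. *)
Definition massey_cocycle : DH_cochain mm_resolution (homology A) (-1) 2 :=
  fun q => (mm_rho (q - -1) \o tw_d X 2 q 0 (q - -1) :
              {linear S 2 q -> homology A (q - -1)}).

Fact massey_cocycleP : DH_d mm_resolution (homology A) (-1) 2 massey_cocycle = 0.
Proof.
apply: functional_extensionality_dep => q; apply: Hom_ext => y.
pose n := 2%:Z + q; pose u := diff X (n + 1) n (inj S 3 q (n + 1) y).
have uF : u \in F 2 n.
  by have := diff_fil d0 erefl (inj_fil (n + 1) y).
have uE : prj S 2 q n u = mm_d1 q 2 y.
  by rewrite (prj_diff d0) ?inj_fil // prj_inj // /n; lia.
have u'F := fil_lead (erefl : 2%:Z + q = n) uF.
have dE : tw_d X 2 q 0 (q + 1) (mm_d1 q 2 y) =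
    - mm_d1 (q + 1) 0 (prj S 1 (q + 1) n (u - inj S 2 q n (prj S 2 q n u))).
  rewrite -(prj_diff d0 (n' := q + 1)) //; [|by rewrite /n; lia..].
  rewrite linearB diff_diff sub0r linearN opprK uE.
  by rewrite (@tw_dE _ X _ _ _ _ n (q + 1)) // /n; lia.
have rhoE : mm_rho (q + 1) (tw_d X 2 q 0 (q + 1) (mm_d1 q 2 y)) = 0.
  by rewrite dE linearN mm_rho_d1 oppr0.
by rewrite DH_dE; apply: etrans (congr1 _ rhoE) (scaler0 _ _).
Qed.

Definition massey_product : DH mm_resolution (homology A) 2 (-1) :=
  cohomology_class massey_cocycleP.
End MinimalModel.

(* Main.v *)
Require Import Defs.
From mathcomp Require Import all_boot all_algebra.
From mathcomp Require Import zify.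

(** A minimal model [f : X ~> A] already contains a chain map from the resolution
    of [H_q(A)] to the homology extension.  As [d_0 = 0] on [X] and [f] is a chain
    map, its components [f_i : X_{i,q} -> A_{q+i}] satisfy
      [d f_0 = 0],  [d f_1 = f_0 d_1],  [d f_2 = f_1 d_1 + f_0 d_2].
    The first two equations say that [f_0] and the class of [f_1] modulo boundaries
    lift the identity of [H_q(A)] in resolution degrees 0 and 1.  The third one says
    that [f_1 d_1] and [- f_0 d_2] agree modulo boundaries, so the lift continues
    in degree 2 with [- rho d_2].  That is the opposite of the Massey cocycle. *)

Set Implicit Arguments.
Unset Strict Implicit.
Unset Printing Implicit Defensive.

Import GRing.Theory.
Local Open Scope ring_scope.

Section MasseyLift.
Variables (k : comPzRingType) (A : complex k) (mm : minimal_model A) (q : int).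
Local Notation X := (mm_tw mm).
Local Notation S := (tw_split X).
Local Notation f := (mm_map mm).
Local Notation F := (fil (tw_filtered X)).
Let d0 := mm_d0 (m := mm).

(** Applied to [d y] with [y] in [X_{2,q}], where [d_0 = 0] gives filtration
    at most 1, this reads [d y = d_1 y + d_2 y]. *)
Lemma fil1_decomp n (u : X n) : n = q + 1 -> u \in F 1 n ->
  u = inj S 1 q n (prj S 1 q n u) + inj S 0 n n (prj S 0 n n u).
Proof.
move=> nE uF; have nE' : 1%:Z + q = n by lia.
have /inj_prj0 := fil_lead nE' uF; rewrite linearB prj_inj0 // subr0 => ->.
by rewrite addrC subrK.
Qed.

(** The component [f_1], whose target [A (q + 1)] is the whole degree [q + 1]
    part because [A] is concentrated in horizontal degree 0. *)
Definition mm_f1 : {linear S 1 q -> A (q + 1)} := f (q + 1) \o inj S 1 q (q + 1).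

Lemma mm_f1E x : mm_f1 x = f (q + 1) (inj S 1 q (q + 1) x).
Proof. by []. Qed.

(** Of [d] on [X_{1,q}] only [d_1] remains: [d_0] is zero, and there is nothing
    in negative horizontal degrees. *)
Lemma mm_f1_diff x : diff A (q + 1) q (mm_f1 x) = mm_f0 mm q (mm_d1 mm q 0 x).
Proof.
have xF := inj_fil (X := X) (q + 1) x.
rewrite mm_f0E mm_f1E cmap_diff -(inj_prj0 (diff_fil d0 erefl xF)).
by rewrite (prj_diff d0) ?add0r // prj_inj // addrC.
Qed.

(** The element [f_2 x] is the homotopy that identifies [f_1 d_1] with
    [- f_0 d_2] modulo boundaries. *)
Lemma mm_f2_diff x :
  diff A (q + 1 + 1) (q + 1) (f (q + 1 + 1) (inj S 2 q (q + 1 + 1) x)) =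
  mm_f1 (mm_d1 mm q 1 x) + mm_f0 mm (q + 1) (tw_d X 2 q 0 (q + 1) x).
Proof.
have xF := inj_fil (X := X) (q + 1 + 1) x.
rewrite cmap_diff mm_f0E mm_f1E -linearD; congr (f _ _).
rewrite [LHS]fil1_decomp //; last exact: (diff_fil d0 erefl xF).
rewrite /mm_d1 (@tw_dE _ X _ _ _ _ (q + 1 + 1) (q + 1)) //; last by lia.
by rewrite (@tw_dE _ X _ _ _ _ (q + 1 + 1) (q + 1)) //; lia.
Qed.

Definition massey_lift2 : {linear S 2 q -> homology A (q + 1)} :=
  \- (mm_rho mm (q + 1) \o tw_d X 2 q 0 (q + 1)).

Lemma massey_lift_comm0 x :
  hext_m A q (quot_proj (boundaries A (q + 1)) (mm_f1 x)) =
  into_submodule (@mm_f0_cycle _ _ mm q) (mm_d1 mm q 0 x).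
Proof. by rewrite hext_mE; apply: val_inj; rewrite /= mm_f1_diff. Qed.

(** [hext_i] sends the homology class of a cycle to its class modulo
    boundaries, so the equation holds because [d f_2 = f_1 d_1 + f_0 d_2]. *)
Lemma massey_lift_comm1 x :
  hext_i A q (massey_lift2 x) =
  quot_proj (boundaries A (q + 1)) (mm_f1 (mm_d1 mm q 1 x)).
Proof.
rewrite linearN [X in - X]hext_iE -linearN; apply/eqP.
rewrite quot_proj_eq -opprD -scaleN1r rpredZ //.
apply/imP; exists (f _ (inj S 2 q _ x)).
by rewrite mm_f2_diff [RHS]addrC.
Qed.

(** In degree 0 the map is [f_0], which lifts the identity of [H_q(A)] by
    definition, as the augmentation [rho] of the resolution is the class of [f_0]. *)
Definition massey_lift :
    yoneda_lift (mm_resolution mm q) (homology_extension A q) :=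
  @YonedaLift _ _ _ (mm_resolution mm q) (homology_extension A q)
    (into_submodule (@mm_f0_cycle _ _ mm q))
    (quot_proj (boundaries A (q + 1)) \o mm_f1) massey_lift2
    (fun=> erefl) massey_lift_comm0 massey_lift_comm1.
End MasseyLift.

Theorem proposition5p1 (k : comPzRingType) (A : complex k)
    (mm : minimal_model A) (q : int) :
  DH_Ext q (massey_product mm) =
  (- yoneda_class (mm_resolution mm q) (homology_extension A q))%R.
Proof.
(* The Massey cocycle takes values in degree [q - -1], the lift in [q + 1];
   the two integers are convertible. *)
have ker_q : piM_proj q (massey_cocycle mm) \in ker _ :=
  DH_ker q (introT eqP (massey_cocycleP mm)).
rewrite (yoneda_classE (massey_lift mm q)) [LHS](subquot_mapE _ _ _ ker_q).
rewrite -[RHS]linearN; congr quot_proj; apply: val_inj.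
by apply: Hom_ext => x; rewrite /= opprK.
Qed.
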